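(* Let $X$ be a non-empty set and let $\mathcal{F}$ be a $C^{\ast}$-subalgebra of $\ell^{\infty}(X)$ containing the constant functions. For an ideal $I$ of $\mathcal{F}$ put $\mathcal{B}(I)=\{X(f,r): f\in I,\ r>0\}$, where $X(f,r)=\{x\in X:|f(x)|\leq r\}$. If $\varphi$ is an $\mathcal{F}$-filter on $X$, then there exists an ideal $I$ of $\mathcal{F}$ such that $\varphi$ is generated by $\mathcal{B}(I)$. Conversely, if $I$ is an ideal of $\mathcal{F}$, then $\mathcal{B}(I)$ is a filter base on $X$ and the filter $\varphi$ on $X$ generated by $\mathcal{B}(I)$ is an $\mathcal{F}$-filter.
   Context: By an ideal of $\mathcal{F}$ is always meant a closed, proper ideal of $\mathcal{F}$. $\ell^{\infty}(X)$ is the $C^{\ast}$-algebra of all bounded complex-valued functions on $X$ (pointwise operations, supremum norm, involution given by complex conjugation). A filter on $X$ is a non-empty family of subsets of $X$ closed under finite intersections and under supersets and not containing $\emptyset$. A filter base on $X$ is a non-empty family $\mathcal{B}$ of non-empty subsets of $X$ such that for all $A,B\in\mathcal{B}$ there is $C\in\mathcal{B}$ with $C\subseteq A\cap B$; the filter generated by $\mathcal{B}$ is $\{A\subseteq X:\ B\subseteq A\text{ for some }B\in\mathcal{B}\}$. An $\mathcal{F}$-family on $X$ is a non-empty set $\mathcal{A}$ of non-empty subsets of $X$ such that for every $A\in\mathcal{A}$ with $A\neq X$ there exist $B\in\mathcal{A}$ and $f\in\mathcal{F}$ with $f(B)=\{0\}$ and $f(X\setminus A)=\{1\}$. An $\mathcal{F}$-filter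 is a filter on $X$ which is also an $\mathcal{F}$-family. *)

(* Defs.v *)
From HB Require Import structures.
From mathcomp Require Import all_boot all_order all_algebra.
From mathcomp Require Import complex.
From mathcomp Require Import all_classical all_reals.

Set Implicit Arguments.
Unset Strict Implicit.
Unset Printing Implicit Defensive.

Import Order.TTheory GRing.Theory Num.Theory.
Import Normc.

Local Open Scope classical_set_scope.
Local Open Scope complex_scope.
Local Open Scope ring_scope.

Section Definitions.
Variables (R : realType) (X : Type).

(* [normc z : R] is the real-valued modulus; [`|z|] would be in [R[i]]. *)
Definition ell_infty : set (X -> R[i]) :=
  [set f | has_ubound (range (fun x => normc (f x)))].

(* Meaningful only on [ell_infty] and for X non-empty, since [sup] is total. *)
Definition supnorm (f : X -> R[i]) : R :=
  sup (range (fun x => normc (f x))).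

(* S is closed relative to E for the metric induced by [supnorm]
   (used with S `<=` E `<=` ell_infty). *)
Definition norm_closed_in (E S : set (X -> R[i])) : Prop :=
  forall f, E f ->
    (forall e : R, 0 < e -> exists2 g, S g & supnorm (f - g) < e) -> S f.

Definition linear_subspace (S : set (X -> R[i])) : Prop :=
  [/\ S 0,
      forall f g, S f -> S g -> S (f + g)
    & forall (c : R[i]) f, S f -> S (c *: f)].

Definition Cstar_subalgebra (F : set (X -> R[i])) : Prop :=
  [/\ F `<=` ell_infty,
      linear_subspace F,
      forall f g, F f -> F g -> F (f * g),
      forall f, F f -> F (fun x => (f x)^*%C)
    & norm_closed_in ell_infty F].

Definition closed_proper_ideal (F I : set (X -> R[i])) : Prop :=
  [/\ I `<=` F,
      linear_subspace I,
      forall f g, F f -> I g -> I (f * g),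
      norm_closed_in F I
    & I <> F].

Definition sublevel (f : X -> R[i]) (r : R) : set X :=
  [set x | normc (f x) <= r].

Definition ideal_base (I : set (X -> R[i])) : set_system X :=
  [set A | exists f, exists r : R, [/\ I f, 0 < r & A = sublevel f r]].

Definition filter_base (B : set_system X) : Prop :=
  [/\ B !=set0,
      forall A, B A -> A !=set0
    & forall A A', B A -> B A' -> exists2 C, B C & C `<=` A `&` A'].

Definition generated_filter (B : set_system X) : set_system X :=
  filter_from B id.

Definition Ffamily (F : set (X -> R[i])) (A : set_system X) : Prop :=
  [/\ A !=set0,
      forall S, A S -> S !=set0
    & forall S, A S -> S <> setT ->
        exists T, exists f,
          [/\ A T, F f, f @` T = [set 0] & f @` (~` S) = [set 1]]].

Definition Ffilter (F : set (X -> R[i])) (phi : set_system X) : Prop :=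
  ProperFilter phi /\ Ffamily F phi.

End Definitions.

(* Main.v *)
Require Import Defs.
From HB Require Import structures.
From mathcomp Require Import all_boot all_order all_algebra.
From mathcomp Require Import complex.
From mathcomp Require Import all_classical all_reals.
From mathcomp Require Import ring lra.

(** From a filter to an ideal: an [F]-filter [phi] is recovered from the
functions that tend to 0 along it, [I] being the set of [f] in [F] all of
whose sublevel sets lie in [phi]. That [I] is a closed proper ideal is the
usual epsilon argument. Conversely, if [S] is in [phi], then the function
vanishing on a member of [phi] and equal to 1 off [S], which the [F]-family
condition provides, lies in [I] and its sublevel set at level 1/2 is inside [S]
([vanishing_ideal_generates]).

From an ideal to a filter: if [f] and [g] are in [I], so is
[|f|^2 + |g|^2], whose sublevel sets are inside those of both [f] and [g];
this gives the intersection property of the base. Two facts need analysis, and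
both are proved for a uniformly closed algebra of real functions, applied to
the real-valued functions of [I] and of [F].

- No sublevel set of [f] in [I] is empty. If [|f| > r > 0] everywhere, then a
  scalar multiple [k] of [|f|^2] satisfies [a <= k <= 1] with [a > 0], and the
  functions [1 - (1 - k)^n], which lie in the ideal, converge uniformly to 1
  ([unit_mem]). This would put 1 in the closed proper ideal [I].

- The sublevel sets of [f] at levels [r / 2] and [r] are separated by a
  function of [F]: it is obtained from [|f|^2] by a formula involving absolute
  values ([separation_mem]), and absolute values stay in the algebra because
  they are uniform limits of polynomials without constant term ([abs_mem]).
  This is exactly the [F]-family condition for the generated filter. *)

Import Order.TTheory GRing.Theory Num.Theory.
Import Normc.

Local Open Scope classical_set_scope.
Local Open Scope complex_scope.
Local Open Scope ring_scope.

(** * Modulus and supremum norm *)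

Section ModulusAndSupnorm.
Context {R : realType}.

Lemma normc_ge0 (z : R[i]) : 0 <= normc z.
Proof. by case: z => a b; apply: sqrtr_ge0. Qed.

Lemma normc_real (a : R) : normc a%:C = `|a|.
Proof. by rewrite /normc /= expr0n addr0 sqrtr_sqr. Qed.

Lemma sqr_normcJ (z : R[i]) : ((normc z) ^+ 2)%:C = z * z^*%C.
Proof. by rewrite rmorphXn /= -sqr_normc; case: z. Qed.

Context {X : Type}.

Lemma ell_inftyP (f : X -> R[i]) :
  ell_infty f <-> exists M, forall x, normc (f x) <= M.
Proof.
split=> [[M Mf]|[M Mf]]; exists M; first by move=> x; apply: Mf; exists x.
by move=> _ [x _ <-].
Qed.

Lemma ell_inftyB (f g : X -> R[i]) :
  ell_infty f -> ell_infty g -> ell_infty (f - g).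
Proof.
move=> /ell_inftyP[M Mf] /ell_inftyP[N Ng]; apply/ell_inftyP; exists (M + N).
move=> x; apply: le_trans (le_normcD _ _) _.
by rewrite normcN lerD.
Qed.

Lemma normc_le_supnorm (f : X -> R[i]) x :
  ell_infty f -> normc (f x) <= supnorm f.
Proof. by move=> bf; apply: ub_le_sup => //; exists x. Qed.

Lemma supnorm_le (f : X -> R[i]) (e : R) : [set: X] !=set0 ->
  (forall x, normc (f x) <= e) -> supnorm f <= e.
Proof.
move=> [x0 _] fe; apply: ge_sup; first by exists (normc (f x0)), x0.
by move=> _ [x _ <-].
Qed.

(** Replaces the strict bound on a supremum in the definition of closedness by
    a pointwise bound, so that no supremum occurs in the approximation
    arguments below. *)
Lemma norm_closed_in_uniform (E S : set (X -> R[i])) f :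
  [set: X] !=set0 -> norm_closed_in E S -> E f ->
  (forall e, 0 < e -> exists2 g, S g & forall x, normc (f x - g x) <= e) ->
  S f.
Proof.
move=> X0 clS Ef fS; apply: clS => // e e0.
have [g Sg fg] := fS (e / 2) (divr_gt0 e0 (ltr0Sn _ 1)).
exists g => //; apply: (@le_lt_trans _ _ (e / 2)); last by lra.
exact: supnorm_le.
Qed.

End ModulusAndSupnorm.

(** * Uniformly closed algebras of real functions *)

Section UniformlyClosedAlgebra.
Context {R : realType} {X : Type}.

(** No unit is required, so that the real parts of [F] and of its ideals are
    both covered. *)
Record uniform_algebra (A : set (X -> R)) : Prop := UniformAlgebra {
  ualg0 : A (fun=> 0);
  ualgD : forall u v, A u -> A v -> A (fun x => u x + v x);
  ualgZ : forall c u, A u -> A (fun x => c * u x);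
  ualgM : forall u v, A u -> A v -> A (fun x => u x * v x);
  ualg_lim : forall u,
    (forall e, 0 < e -> exists2 v, A v & forall x, `|u x - v x| <= e) -> A u }.

Variable A : set (X -> R).
Hypothesis algA : uniform_algebra A.

Lemma ualgB u v : A u -> A v -> A (fun x => u x - v x).
Proof.
move=> Au Av; have := ualgD _ algA _ _ Au (ualgZ _ algA (-1) _ Av).
by congr A; apply/funext => x; rewrite mulN1r.
Qed.

(** This is [1 - (1 - k)^n]; the recursive form shows that it stays in an
    algebra without unit. *)
Fixpoint neumann (k : X -> R) (n : nat) (x : X) : R :=
  if n is m.+1 then neumann k m x + (k x - k x * neumann k m x) else 0.

(** By Bernoulli's inequality [1 + n a <= (1 + a)^n], the left-hand side is at
    most [(1 - a^2)^n]; it gives an explicit rate for the geometric decay. *)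
Lemma bernoulli_decay (a : R) n : 0 <= a <= 1 ->
  (1 + n%:R * a) * (1 - a) ^+ n <= 1.
Proof.
move=> /andP[a0 a1]; elim: n => [|n IHn]; first by rewrite mul0r addr0 mul1r.
apply: le_trans IHn; rewrite exprS mulrA ler_wpM2r ?exprn_ge0 ?subr_ge0//.
have n0 : 0 <= n%:R :> R by [].
rewrite -natr1; nra.
Qed.

(** An algebra containing a function bounded away from 0 contains 1: the
    partial sums of the Neumann series of [k / k] converge uniformly to it,
    with error [(1 - k)^n <= (1 - a)^n]. *)
Lemma unit_mem (k : X -> R) (a : R) : A k -> 0 < a ->
  (forall x, a <= k x <= 1) -> A (fun=> 1).
Proof.
move=> Ak a0 ak; apply: (ualg_lim _ algA) => e e0.
(* [n e a > 1] makes [1 / (1 + n a)], a bound for the error, at most [e]. *)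
have [n en] : exists n : nat, (e * a)^-1 < n%:R.
  by exists (Num.bound (e * a)^-1); apply: archi_boundP; rewrite invr_ge0 mulr_ge0 ?ltW.
exists (neumann k n).
  elim: n {en} => [|n IHn] /=; first exact: (ualg0 _ algA).
  by apply: (ualgD _ algA) => //; apply: ualgB => //; exact: (ualgM _ algA).
move=> x; have /andP[akx k1] := ak x.
have -> : 1 - neumann k n x = (1 - k x) ^+ n.
  elim: n {en} => [|n IHn] /=; first by rewrite subr0.
  by rewrite exprS -IHn; ring.
rewrite ger0_norm ?exprn_ge0 ?subr_ge0//.
have p0 : 0 <= (1 - k x) ^+ n by rewrite exprn_ge0 ?subr_ge0.
have kb : 0 <= k x <= 1 by apply/andP; split => //; lra.
have := bernoulli_decay _ n kb.
set p := _ ^+ n in p0 *; move=> pb.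
have ena : 1 < n%:R * (e * a).
  by rewrite -ltr_pdivrMr ?mulr_gt0// div1r.
have enk : n%:R * (e * a) <= n%:R * (e * k x).
  by rewrite ler_wpM2l// ler_wpM2l// ltW.
have : e * ((1 + n%:R * k x) * p) <= e * 1 by rewrite ler_wpM2l// ltW.
suff : p <= e * ((1 + n%:R * k x) * p) by lra.
rewrite mulrA ler_peMl//; nra.
Qed.

(** The classical polynomial iteration for the square root of [u^2]. *)
Fixpoint abs_approx (u : X -> R) (n : nat) (x : X) : R :=
  if n is m.+1 then
    abs_approx u m x + 2^-1 * (u x * u x - abs_approx u m x * abs_approx u m x)
  else 0.

(** With [s = |u x|], the error [e = s - p] evolves as
    [e' = e (1 - s + e / 2)], hence [e' <= e - e^2 / 2] because [e <= s]. From
    [e <= 1] at the start, this recursion forces [e <= 2 / (n + 2)], a rate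
    independent of the point. *)
Lemma abs_approx_error (u : X -> R) n x : `|u x| <= 1 ->
  [/\ 0 <= abs_approx u n x, abs_approx u n x <= `|u x|
    & `|u x| - abs_approx u n x <= 2 / n.+2%:R].
Proof.
move=> u1; have s0 := normr_ge0 (u x).
have uu : u x * u x = `|u x| * `|u x| by rewrite -normrM ger0_norm// -expr2 sqr_ge0.
elim: n => [|n [p0 ps pe]] /=.
  by split => //; rewrite subr0 divff ?pnatr_eq0.
rewrite uu; move: `|u x| (abs_approx u n x) u1 s0 p0 ps pe => s p u1 s0 p0 ps pe.
split; [nra|nra|].
set d := 2 / n.+2%:R in pe.
have d1 : d <= 1 by rewrite ler_pdivrMr// mul1r ler_nat.
have d0 : 0 < d by rewrite divr_gt0.
(* [t - t^2 / 2] increases on [0, 1], so the bound [d] may replace [e]. *)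
apply: (@le_trans _ _ (d - d ^+ 2 / 2)); first by rewrite expr2; nra.
rewrite /d -(natr1 n.+2) -(natr1 n.+1) -(natr1 n).
have n0 : 0 <= n%:R :> R by [].
move: (n%:R : R) n0 => t n0.
rewrite -subr_ge0.
have -> : 2 / (t + 1 + 1 + 1) - (2 / (t + 1 + 1) - (2 / (t + 1 + 1)) ^+ 2 / 2)
  = 2 / ((t + 1 + 1 + 1) * (t + 1 + 1) ^+ 2).
  by field; apply/andP; split; lra.
rewrite divr_ge0// mulr_ge0 ?sqr_ge0//; lra.
Qed.

Lemma abs_mem_le1 u : A u -> (forall x, `|u x| <= 1) -> A (fun x => `|u x|).
Proof.
move=> Au u1; apply: (ualg_lim _ algA) => e e0.
exists (abs_approx u (Num.bound (2 / e))).
  elim: (Num.bound _) => [|n IHn] /=; first exact: (ualg0 _ algA).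
  apply: (ualgD _ algA) => //; apply: (ualgZ _ algA).
  by apply: ualgB; apply: (ualgM _ algA).
move=> x; set n := Num.bound _.
have [p0 ps pe] := abs_approx_error u n x (u1 x).
rewrite ger0_norm ?subr_ge0//; apply: le_trans pe _.
have en : 2 / e < n%:R by apply: archi_boundP; rewrite divr_ge0// ltW.
rewrite ler_pdivrMr// mulrC -ler_pdivrMr//.
by rewrite ltW// (lt_le_trans en)// ler_nat ltnW.
Qed.

Lemma abs_mem u (M : R) : A u -> (forall x, `|u x| <= M) ->
  A (fun x => `|u x|).
Proof.
move=> Au uM; pose N := `|M| + 1.
have N0 : 0 < N by rewrite ltr_wpDl.
have := ualgZ _ algA N _ (abs_mem_le1 _ (ualgZ _ algA N^-1 _ Au) _).
have -> : (fun x => N * `|N^-1 * u x|) = (fun x => `|u x|).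
  apply/funext => x; rewrite normrM gtr0_norm ?invr_gt0//.
  by rewrite mulrA divff ?mul1r// gt_eqF.
apply=> x; rewrite normrM gtr0_norm ?invr_gt0// mulrC ler_pdivrMr// mul1r.
by apply: le_trans (uM x) _; rewrite /N; have := ler_norm M; lra.
Qed.

(** The function [v] is the piecewise linear ramp from 0 at [a] to 1 at [b],
    composed with [u]; written with absolute values, it belongs to the algebra
    by [abs_mem]. *)
Lemma separation_mem u (M a b : R) : A (fun=> 1) -> A u ->
  (forall x, `|u x| <= M) -> a < b ->
  exists v, [/\ A v, forall x, u x <= a -> v x = 0
              & forall x, b <= u x -> v x = 1].
Proof.
move=> A1 Au uM ab.
have Acst c : A (fun=> c).
  by have := ualgZ _ algA c _ A1; congr A; apply/funext => x; rewrite mulr1.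
have Aabs c : A (fun x => `|u x - c|).
  apply: (abs_mem _ (M + `|c|)); first exact: ualgB.
  by move=> x; apply: le_trans (ler_normB _ _) _; rewrite lerD2r.
exists (fun x => (2 * (b - a))^-1 * (`|u x - a| - `|u x - b| + (b - a))); split.
- by apply: (ualgZ _ algA); apply: (ualgD _ algA) => //; apply: ualgB.
- move=> x ua; rewrite !ler0_norm; [|lra|lra].
  by rewrite [X in _ * X](_ : _ = 0) ?mulr0//; ring.
- move=> x bu; rewrite !ger0_norm; [|lra|lra].
  by field; lra.
Qed.

End UniformlyClosedAlgebra.

Section RealFunctions.
Context {R : realType} {X : Type}.

Definition real_functions (S : set (X -> R[i])) : set (X -> R) :=
  [set u | S (fun x => (u x)%:C)].

Lemma real_functions_uniform_algebra (S : set (X -> R[i])) :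
  linear_subspace S -> (forall f g, S f -> S g -> S (f * g)) ->
  (forall f, (forall e, 0 < e ->
     exists2 g, S g & forall x, normc (f x - g x) <= e) -> S f) ->
  uniform_algebra (real_functions S).
Proof.
move=> [S0 SD SZ] SM Slim; split; rewrite /real_functions /=.
- exact: S0.
- move=> u v Su Sv; have := SD _ _ Su Sv.
  by congr S; apply/funext => x /=; rewrite rmorphD.
- move=> c u Su; have := SZ c%:C _ Su.
  by congr S; apply/funext => x /=; rewrite rmorphM.
- move=> u v Su Sv; have := SM _ _ Su Sv.
  by congr S; apply/funext => x /=; rewrite rmorphM.
- move=> u ulim; apply: Slim => e /ulim[v Sv uv].
  by exists (fun x => (v x)%:C) => // x; rewrite -rmorphB normc_real.
Qed.

End RealFunctions.

(** * Ideals and filters *)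

Section IdealsAndFilters.
Context {R : realType} {X : Type} (X_nonempty : [set: X] !=set0).
Context {F : set (X -> R[i])} (F_Cstar : Cstar_subalgebra F).
Hypothesis F_cst : forall c : R[i], F (cst c).

Lemma Cstar_bounded f : F f -> exists M, forall x, normc (f x) <= M.
Proof. by case: F_Cstar => Fl _ _ _ _ /Fl /ell_inftyP. Qed.

Lemma Cstar_uniform_limit f :
  (forall e, 0 < e -> exists2 g, F g & forall x, normc (f x - g x) <= e) ->
  F f.
Proof.
case: (F_Cstar) => _ _ _ _ clF flim.
apply: (norm_closed_in_uniform _ _ _ X_nonempty clF) => //.
have [g /Cstar_bounded[M Mg] fg] := flim 1 ltr01.
apply/ell_inftyP; exists (1 + M) => x.
by rewrite -[f x](subrK (g x)) (le_trans (le_normcD _ _))// lerD.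
Qed.

Lemma Cstar_real_uniform_algebra : uniform_algebra (real_functions F).
Proof.
case: (F_Cstar) => _ linF FM _ _.
by apply: real_functions_uniform_algebra => //; apply: Cstar_uniform_limit.
Qed.

Section FromIdeal.
Context {I : set (X -> R[i])} (idealI : closed_proper_ideal F I).

Lemma ideal_sub : I `<=` F. Proof. by case: idealI. Qed.

Lemma ideal_real_uniform_algebra : uniform_algebra (real_functions I).
Proof.
case: (idealI) => _ linI IM clI _.
apply: real_functions_uniform_algebra => //.
  by move=> f g /ideal_sub; apply: IM.
move=> f flim; apply: (norm_closed_in_uniform _ _ _ X_nonempty clI) => //.
by apply: Cstar_uniform_limit => e /flim[g /ideal_sub Fg fg]; exists g.
Qed.

(** The modulus is squared because [|f|^2] is the product of [f] and its
    conjugate, hence visibly in the ideal. *)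
Lemma ideal_normc2 f : I f -> real_functions I (fun x => normc (f x) ^+ 2).
Proof.
move=> If; case: (F_Cstar) => _ _ _ FJ _; case: (idealI) => _ _ IM _ _.
have := IM _ _ (FJ _ (ideal_sub _ If)) If.
by congr I; apply/funext => x; rewrite sqr_normcJ mulrC.
Qed.

Lemma ideal_not1 : ~ I (cst 1).
Proof.
case: (idealI) => _ _ IM _ IF I1; apply: IF; apply/seteqP; split.
  exact: ideal_sub.
move=> f Ff; have := IM _ _ Ff I1.
by congr I; apply/funext => x; apply: mulr1.
Qed.

Lemma normc2_le (z : R[i]) (M : R) : normc z <= M -> normc z ^+ 2 <= M ^+ 2.
Proof.
by move=> zM; rewrite ler_pXn2r// nnegrE (le_trans (normc_ge0 z))// normc_ge0.
Qed.

(** An empty sublevel set would make [f] bounded away from 0, and a proper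
    ideal contains no such function. *)
Lemma sublevel_nonempty f r : I f -> 0 < r -> sublevel f r !=set0.
Proof.
move=> If r0; apply: contrapT => empty; apply: ideal_not1.
have rf x : r < normc (f x).
  by rewrite ltNge; apply/negP => fr; apply: empty; exists x.
have [M Mf] := Cstar_bounded _ (ideal_sub _ If).
have algI := ideal_real_uniform_algebra.
have M0 : 0 < M.
  by have [x _] := X_nonempty; have := rf x; have := Mf x; lra.
apply: (unit_mem _ algI (fun x => (M ^+ 2)^-1 * normc (f x) ^+ 2)
                        ((M ^+ 2)^-1 * r ^+ 2)).
- by apply: (ualgZ _ algI); apply: ideal_normc2.
- by rewrite mulr_gt0 ?invr_gt0 ?exprn_gt0.
- move=> x; apply/andP; split.
    rewrite ler_wpM2l ?invr_ge0 ?sqr_ge0// ler_pXn2r// ?nnegrE ?normc_ge0 ?ltW//.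
  by rewrite mulrC ler_pdivrMr ?exprn_gt0// mul1r normc2_le.
Qed.

Lemma ideal_filter_base : filter_base (ideal_base I).
Proof.
have algI := ideal_real_uniform_algebra; split.
- by exists (sublevel (0 : X -> R[i]) 1), 0, 1; split => //; case: idealI => _ [].
- by move=> _ [f [r [If r0 ->]]]; apply: sublevel_nonempty.
(* A bound on [|f|^2 + |g|^2] bounds [|f|] and [|g|] simultaneously. *)
move=> _ _ [f [r [If r0 ->]]] [g [s [Ig s0 ->]]].
pose h x : R := normc (f x) ^+ 2 + normc (g x) ^+ 2.
pose t := Num.min r s ^+ 2.
have m0 : 0 < Num.min r s by rewrite lt_min r0.
exists (sublevel (fun x => (h x)%:C) t).
  exists (fun x => (h x)%:C), t; split => //; last by rewrite exprn_gt0.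
  by apply: (ualgD _ algI); apply: ideal_normc2.
move=> x hx; have ht : h x <= t.
  by rewrite -[h x]ger0_norm ?addr_ge0 ?sqr_ge0// -normc_real.
rewrite /sublevel /=.
suff key z : normc z ^+ 2 <= h x -> normc z <= Num.min r s.
  have /key : normc (f x) ^+ 2 <= h x by rewrite lerDl sqr_ge0.
  have /key : normc (g x) ^+ 2 <= h x by rewrite lerDr sqr_ge0.
  by rewrite !le_min => /andP[_ ->] /andP[->].
move=> zh; rewrite -(@ler_pXn2r _ 2)// ?nnegrE ?normc_ge0 ?(ltW m0)//.
exact: le_trans zh ht.
Qed.

Lemma ideal_generated_filter : ProperFilter (generated_filter (ideal_base I)).
Proof.
have [B0 Bne BI] := ideal_filter_base.
by apply: filter_from_proper => //; apply: filter_from_filter.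
Qed.

(** Given [S] containing the sublevel set of [f] at level [r], the member of
    the filter on which the separating function vanishes is the sublevel set
    at level [r / 2]. Both it and the complement of [S] must be inhabited for
    the images to be full singletons. *)
Lemma ideal_Ffilter : Ffilter F (generated_filter (ideal_base I)).
Proof.
have Phi := ideal_generated_filter; split => //; split.
- by exists setT; apply: filterT.
- by move=> S; apply: filter_ex.
move=> S [_ [f [r [If r0 ->]]] fS] SnT.
have [M Mf] := Cstar_bounded _ (ideal_sub _ If).
have [v [Fv v0 v1]] : exists v, [/\ real_functions F v,
    forall x, normc (f x) ^+ 2 <= (r / 2) ^+ 2 -> v x = 0
  & forall x, r ^+ 2 <= normc (f x) ^+ 2 -> v x = 1].
  apply: (separation_mem _ Cstar_real_uniform_algebra _ (M ^+ 2)).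
  - exact: F_cst.
  - exact/ideal_sub/ideal_normc2.
  - by move=> x; rewrite ger0_norm ?sqr_ge0// normc2_le.
  - by rewrite ltr_pXn2r// ?nnegrE; lra.
have r20 : 0 < r / 2 by rewrite divr_gt0.
have [y fy] := sublevel_nonempty _ _ If r20.
have [z Sz] : ~` S !=set0.
  apply: contrapT => /set0P/negP; rewrite negbK => /eqP S0.
  by apply: SnT; rewrite -[S]setCK S0 setC0.
have vS x : ~ S x -> (v x)%:C = 1.
  move=> Sx; rewrite v1// ltW// ltr_pXn2r// ?nnegrE ?normc_ge0 ?ltW//.
  by rewrite ltNge; apply/negP => /fS.
have vT x : sublevel f (r / 2) x -> (v x)%:C = 0.
  by move=> fx; rewrite v0//; apply: normc2_le.
exists (sublevel f (r / 2)), (fun x => (v x)%:C); split => //.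
- by exists (sublevel f (r / 2)) => //; exists f, (r / 2).
- apply/seteqP; split=> [_ [x /vT -> <-]//|_ ->].
  by exists y => //; apply: vT.
- apply/seteqP; split=> [_ [x /vS -> <-]//|_ ->].
  by exists z => //; apply: vS.
Qed.

End FromIdeal.

Section FromFilter.
Context {phi : set_system X} (phiF : Ffilter F phi).

(** The functions of [F] that tend to 0 along [phi]. *)
Definition vanishing_ideal : set (X -> R[i]) :=
  [set f | F f /\ forall r : R, 0 < r -> phi (sublevel f r)].

Lemma vanishing_ideal_closed_proper : closed_proper_ideal F vanishing_ideal.
Proof.
case: (F_Cstar) => Fl [F0 FD FZ] FM _ _; case: phiF => Phi _.
have phiM f g : F f -> vanishing_ideal g -> vanishing_ideal (f * g).
  move=> Ff [Fg phig]; split=> [|r r0]; first exact: FM.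
  have [M Mf] := Cstar_bounded _ Ff.
  have N0 : 0 < `|M| + 1 by rewrite ltr_wpDl.
  apply: filterS (phig (r / (`|M| + 1)) (divr_gt0 r0 N0)) => x.
  rewrite /sublevel /= ler_pdivlMr// mulrC normcM => gr.
  apply: le_trans gr; rewrite ler_wpM2r ?normc_ge0//.
  by apply: le_trans (Mf x) _; have := ler_norm M; lra.
split.
- by move=> f [].
- split.
  + split=> // r r0; apply: filterS filterT => x _.
    by change (normc (0 : R[i]) <= r); rewrite normc0 ltW.
  + move=> f g [Ff phif] [Fg phig]; split=> [|r r0]; first exact: FD.
    have r20 : 0 < r / 2 by rewrite divr_gt0.
    apply: filterS (filterI (phif _ r20) (phig _ r20)) => x [].
    rewrite /sublevel /= => fr gr; apply: le_trans (le_normcD _ _) _; lra.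
  + move=> c f If; exact: (phiM (cst c)).
- exact: phiM.
- move=> f Ff flim; split=> // r r0.
  have r20 : 0 < r / 2 by rewrite divr_gt0.
  have [g [Fg phig] fg] := flim _ r20.
  apply: filterS (phig _ r20) => x; rewrite /sublevel /= => gr.
  have := normc_le_supnorm _ x (ell_inftyB _ _ (Fl _ Ff) (Fl _ Fg)).
  have := le_normcD (f x - g x) (g x); rewrite subrK.
  rewrite [(f - g) x]/=; lra.
- move=> IF; have [_ /(_ 2^-1)] : vanishing_ideal (cst 1) by rewrite IF.
  rewrite invr_gt0 ltr0n => /(_ isT)/filter_ex[x].
  by change (normc (1 : R[i]) <= 2^-1 -> False); rewrite normc1; lra.
Qed.

(** The function attached to [S] by the [F]-family condition belongs to the
    ideal, since each of its sublevel sets contains the member of [phi] on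
    which it vanishes; being 1 off [S], it is small only inside [S]. *)
Lemma vanishing_ideal_generates :
  phi = generated_filter (ideal_base vanishing_ideal).
Proof.
case: (phiF) => Phi [_ _ sep]; case: (F_Cstar) => _ [F0 _ _] _ _ _.
apply/seteqP; split=> [S phiS|S [_ [f [r [[_ phif] r0 ->]]] fS]]; last first.
  exact: filterS fS (phif _ r0).
have [->|SnT] := pselect (S = setT).
  exists (sublevel (0 : X -> R[i]) 1) => //; exists 0, 1; split => //.
  by have [_ [I0 _ _] _ _ _] := vanishing_ideal_closed_proper.
have [T [f [phiT Ff fT fS]]] := sep _ phiS SnT.
exists (sublevel f 2^-1).
  exists f, 2^-1; split=> //; last by rewrite invr_gt0.
  split=> // r r0; apply: filterS phiT => x Tx.
  have /= fx : [set 0] (f x) by rewrite -fT; exists x.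
  by rewrite /sublevel /= fx normc0 ltW.
move=> x; rewrite /sublevel /= => fx; apply: contrapT => Sx.
have /= fx1 : [set 1] (f x) by rewrite -fS; exists x.
by move: fx; rewrite fx1 normc1; lra.
Qed.

End FromFilter.

End IdealsAndFilters.

Theorem theorem32 (R : realType) (X : Type) (X_nonempty : [set: X] !=set0)
    (F : set (X -> R[i])) (F_Cstar : Cstar_subalgebra F)
    (F_cst : forall c : R[i], F (cst c)) :
  (forall phi : set_system X, Ffilter F phi ->
     exists2 I : set (X -> R[i]),
       closed_proper_ideal F I & phi = generated_filter (ideal_base I))
  /\
  (forall I : set (X -> R[i]), closed_proper_ideal F I ->
     filter_base (ideal_base I)
     /\ Ffilter F (generated_filter (ideal_base I))).
Proof.
split=> [phi phiF|I idealI].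
  exists (@vanishing_ideal R X F phi).
    exact: vanishing_ideal_closed_proper.
  exact: vanishing_ideal_generates.
split; first exact: (ideal_filter_base X_nonempty F_Cstar idealI).
exact: ideal_Ffilter.
Qed.
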